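(* Let $(W,S)$ be a Coxeter system of finite rank such that $W$ is infinite and irreducible, with root system $\Phi$. (1) Any essential element of $W$ has infinite order. (2) Let $0\neq k\in\mathbb{Z}$. Then $w\in W$ is essential in $W$ if and only if $w^k$ is essential in $W$. (3) If $n=|S|$ and $\gamma_1,\dots,\gamma_n\in\Phi$ are linearly independent, then $s_{\gamma_1}\cdots s_{\gamma_n}$ is essential in $W$. Hence any Coxeter element of $W$ is essential in $W$.
   Context: For a Coxeter system $(W,S)$ with $m_{s,t}$ the order of $st$, the rank is $|S|$, and $W$ is irreducible if its Coxeter graph (vertex set $S$, with $s,t$ joined iff $m_{s,t}\ge3$) is connected. The geometric representation space $V$ is the real vector space with basis $\{\alpha_s\mid s\in S\}$ and symmetric bilinear form determined by $\langle\alpha_s,\alpha_t\rangle=-\cos(\pi/m_{s,t})$ if $m_{s,t}<\infty$ and $\langle\alpha_s,\alpha_t\rangle=-1$ if $m_{s,t}=\infty$, with $W$ acting by $s\cdot v=v-2\langle\alpha_s,v\rangle\alpha_s$ for $s\in S$, $v\in V$. The root system is $\Phi=\{w\cdot\alpha_s\mid w\in W,\ s\in S\}$, and for $\gamma=w\cdot\alpha_s\in\Phi$, $s_\gamma=wsw^{-1}$ is the reflection along $\gamma$. A parabolic subgroup is a subgroup of $W$ conjugate to some $W_I=\langle I\rangle$, $I\subseteq S$. For $w\in W$ the parabolic closure $\mathrm{P}(w)$ is the unique minimal parabolic subgroup containing $w$. An element $w\in W$ is essential in $W$ if $\mathrm{P}(w)=W$. A Coxeter element of $W$ is a product $s_1s_2\cdots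 s_n$ of all the elements of $S=\{s_1,\dots,s_n\}$, each occurring once, in some order. *)

(* Defs.v *)
From mathcomp Require Import all_boot all_order all_algebra.
From mathcomp Require Import all_classical all_reals.
From mathcomp Require Import trigo.
From mathcomp Require Import ring.

Set Implicit Arguments.
Unset Strict Implicit.
Unset Printing Implicit Defensive.

Import Order.TTheory GRing.Theory Num.Theory.

Local Open Scope classical_set_scope.
Local Open Scope group_scope.

Section GroupNotions.
Variable W : groupType.
Implicit Types (x w : W) (A H : set W).

(* 0 encodes infinite order. *)
Definition ord x : nat :=
  if pselect (exists n, (0 < n)%N && (x ^+ n == 1)) is left e
  then ex_minn e else 0%N.

Definition infinite_order x := forall n : nat, (0 < n)%N -> x ^+ n <> 1.

Definition zpow x (k : int) : W :=
  match k with Posz n => x ^+ n | Negz n => x ^- n.+1 end.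

Definition subgroup H := group_closed (mem H).

Definition generated A : set W := smallest subgroup A.

Definition conjugate x H : set W := [set x * h * x^-1 | h in H].

Lemma ordP x : (0 < ord x)%N -> x ^+ (ord x) = 1.
Proof.
by rewrite /ord; case: pselect => // e _; case: ex_minnP => k /andP[_ /eqP].
Qed.

Lemma ordC x y : ord (x * y) = ord (y * x).
Proof.
have P (a b : W) k : (a * b) ^+ k = 1 -> (b * a) ^+ k = 1.
  move=> abk; have <- : ((a * b) ^ a) ^+ k = (b * a) ^+ k.
    by rewrite conjgE !mulgA mulVg mul1g.
  by rewrite -conjXg abk conj1g.
have E k : (0 < k)%N && ((x * y) ^+ k == 1) = (0 < k)%N && ((y * x) ^+ k == 1).
  by congr andb; apply/eqP/eqP; apply: P.
rewrite /ord; case: pselect => [e|ne]; case: pselect => [e'|ne'] //.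
- exact: eq_ex_minn.
- by case: ne'; case: e => k; rewrite E; exists k.
- by case: ne; case: e' => k; rewrite -E; exists k.
Qed.

Lemma ord_eq1 x : ord x = 1%N -> x = 1.
Proof. by move=> o1; rewrite -[x]expg1 -o1 ordP // o1. Qed.

End GroupNotions.

Section CoxeterSystem.
Variables (W : groupType) (S : finType) (g : S -> W).

Definition cox_m s t : nat := ord (g s * g t).

Definition word_prod (u : seq S) : W := \prod_(s <- u) g s.

(* The congruence on words generated by (st)^m(s,t) ~ 1.  No relation is
   imposed when m(s,t) = oo, as the relator is then the empty word. *)
Inductive word_equiv : seq S -> seq S -> Prop :=
| word_equiv_refl u : word_equiv u u
| word_equiv_sym u v : word_equiv u v -> word_equiv v u
| word_equiv_trans u v w :
    word_equiv u v -> word_equiv v w -> word_equiv u w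
| word_equiv_relator u v s t :
    word_equiv (u ++ flatten (nseq (cox_m s t) [:: s; t]) ++ v) (u ++ v).

(* W = < S | (st)^m(s,t) = 1 >, where g identifies S with a set of
   involutions of W.  Since the relators include s^2, the monoid
   presentation is the group presentation. *)
Definition coxeter_system : Prop :=
  [/\ injective g,
      forall s, ord (g s) = 2%N,
      forall w, exists u, w = word_prod u
    & forall u v, word_prod u = word_prod v -> word_equiv u v].

Definition cox_graph : rel S :=
  [rel s t | (cox_m s t == 0%N) || (3 <= cox_m s t)%N].

Definition irreducible_system : Prop := forall s t, connect cox_graph s t.

Definition standard_parabolic (I : set S) : set W := generated (g @` I).

Definition parabolic (P : set W) : Prop :=
  exists x I, P = conjugate x (standard_parabolic I).

Definition minimal_parabolic_containing (w : W) (P : set W) : Prop :=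
  [/\ parabolic P, P w
    & forall Q, parabolic Q -> Q w -> Q `<=` P -> Q = P].

Definition parabolic_closure (w : W) (P : set W) : Prop :=
  minimal_parabolic_containing w P /\
  forall Q, minimal_parabolic_containing w Q -> Q = P.

Definition essential (w : W) : Prop := parabolic_closure w [set: W].

Definition coxeter_element (w : W) : Prop :=
  exists2 u : seq S, perm_eq u (enum S) & w = word_prod u.

End CoxeterSystem.

Section GeometricRepresentation.
Variables (R : realType) (W : groupType) (S : finType) (g : S -> W).

Local Open Scope ring_scope.

Definition geom_space := {ffun S -> R^o}.

Definition simple_root (s : S) : geom_space := [ffun t => (t == s)%:R].

Definition cox_form (s t : S) : R :=
  if cox_m g s t == 0%N then - 1 else - cos (pi / (cox_m g s t)%:R).

Definition bform (u v : geom_space) : R :=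
  \sum_(s : S) \sum_(t : S) u s * v t * cox_form s t.

Definition simple_refl (s : S) (v : geom_space) : geom_space :=
  v - (2 * bform (simple_root s) v) *: simple_root s.

Definition word_act (u : seq S) (v : geom_space) : geom_space :=
  foldr simple_refl v u.

(* The action of w is computed along a chosen expression of w; by
   geom_act_word below, the choice is irrelevant. *)
Definition geom_act (w : W) : geom_space -> geom_space :=
  word_act (xget [::] [set u | w = word_prod g u]).

Definition root_system : set geom_space :=
  [set c | exists w s, c = geom_act w (simple_root s)].

(* r is a reflection s_c; a relation, because the expression of c as
   w . alpha_s is not unique. *)
Definition reflection_along (c : geom_space) (r : W) : Prop :=
  exists w s, c = geom_act w (simple_root s) /\ r = (w * g s * w^-1)%g.

Lemma bformDr u v w : bform u (v + w) = bform u v + bform u w.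
Proof.
rewrite /bform -big_split; apply: eq_bigr => s _; rewrite -big_split.
by apply: eq_bigr => t _; rewrite !ffunE mulrDr mulrDl.
Qed.

Lemma bformZr u a v : bform u (a *: v) = a * bform u v.
Proof.
rewrite /bform mulr_sumr; apply: eq_bigr => s _; rewrite mulr_sumr.
by apply: eq_bigr => t _; rewrite !ffunE mulrCA !mulrA.
Qed.

Lemma bform_simple s t : bform (simple_root s) (simple_root t) = cox_form s t.
Proof.
rewrite /bform (bigD1 s) //= [X in _ + X]big1 ?addr0 => [|i /negPf nis]; last first.
  by rewrite big1 // => j _; rewrite !ffunE nis !mul0r.
rewrite (bigD1 t) //= big1 ?addr0 => [|j /negPf njt]; rewrite !ffunE ?eqxx.
  by rewrite !mul1r.
by rewrite njt mulr0 mul0r.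
Qed.

Lemma cox_formC s t : cox_form s t = cox_form t s.
Proof. by rewrite /cox_form /cox_m ordC. Qed.

Hypothesis hcox : coxeter_system g.

Lemma cox_m_diag s : cox_m g s s = 1%N.
Proof.
have [_ /(_ s) o2 _ _] := hcox.
have gg : (g s * g s = 1)%g by rewrite -[RHS](@ordP _ (g s)) o2.
rewrite /cox_m gg /ord; case: pselect => [e|]; last first.
  by case; exists 1%N; rewrite expg1n eqxx.
case: ex_minnP => k /andP[k_gt0 _] /(_ 1%N); rewrite expg1n eqxx => /(_ isT) k_le1.
by apply/eqP; rewrite eqn_leq k_le1 k_gt0.
Qed.

Lemma cox_m_eq1 s t : cox_m g s t = 1%N -> s = t.
Proof.
have [ginj _ _ _] := hcox => /ord_eq1 gst; apply: ginj.
have /ord_eq1 gtt := cox_m_diag t.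
by apply: (mulIg (g t)); rewrite gst gtt.
Qed.

Lemma simple_reflK s : involutive (simple_refl s).
Proof.
move=> v; have q : bform (simple_root s) (simple_root s) = 1.
  by rewrite bform_simple /cox_form cox_m_diag divr1 cospi opprK.
rewrite /simple_refl -!scaleNr bformDr bformZr q.
by apply/ffunP => i; rewrite !ffunE /GRing.scale /=; ring.
Qed.

Lemma dihedral_relation s t v :
  iter (cox_m g s t) (simple_refl s \o simple_refl t) v = v.
Proof.
case: (posnP (cox_m g s t)) => [-> //|m_gt0].
have [m1|m_neq1] := eqVneq (cox_m g s t) 1%N.
  by rewrite m1 /= (cox_m_eq1 m1) simple_reflK.
have m_gt1 : (1 < cox_m g s t)%N by rewrite ltn_neqAle eq_sym m_neq1.
set m := cox_m g s t in m_gt0 m_gt1 *; set th : R := pi / m%:R.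
have mR : (0 : R) < m%:R by rewrite ltr0n.
have m0 := lt0r_neq0 mR.
have sin_gt0 : 0 < sin th.
  apply: sin_gt0_pi; rewrite /th divr_gt0 ?pi_gt0 //=.
  by rewrite ltr_pdivrMr // ltr_pMr ?pi_gt0 // ltr1n.
have sin0 := lt0r_neq0 sin_gt0.
set c := cos th; set sn := sin th in sin_gt0 sin0.
have sc : sn ^+ 2 = 1 - c ^+ 2 by rewrite /sn /c sin2cos2.
set A := simple_root s; set B := simple_root t.
have bAB : bform A B = - c.
  by rewrite bform_simple /cox_form -/m -[m == 0%N]negbK -lt0n m_gt0.
have bBA : bform B A = - c by rewrite bform_simple cox_formC -bform_simple.
have bAA : bform A A = 1.
  by rewrite bform_simple /cox_form cox_m_diag divr1 cospi opprK.
have bBB : bform B B = 1.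
  by rewrite bform_simple /cox_form cox_m_diag divr1 cospi opprK.
set p := bform A v; set q := bform B v.
pose x := (p + c * q) / sn ^+ 2; pose y := (q + c * p) / sn ^+ 2.
pose u := v - x *: A - y *: B.
have s2 : 1 - c ^+ 2 != 0 by rewrite -sc expf_neq0.
have uA : bform A u = 0.
  rewrite /u -!scaleNr !bformDr !bformZr bAA bAB /x /y sc -/p; by field.
have uB : bform B u = 0.
  rewrite /u -!scaleNr !bformDr !bformZr bBA bBB /x /y sc -/q; by field.
have vE : v = u + x *: A + y *: B.
  by apply/ffunP => i; rewrite !ffunE /GRing.scale /=; ring.
clearbody u.
have step a b : (simple_refl s \o simple_refl t) (u + a *: A + b *: B) =
    u + ((4 * c ^+ 2 - 1) * a - 2 * c * b) *: A + (2 * c * a - b) *: B.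
  rewrite /= /simple_refl -/A -/B -!scaleNr !bformDr !bformZr.
  rewrite uA uB bAA bAB bBA bBB.
  by apply/ffunP => i; rewrite !ffunE /GRing.scale /=; ring.
pose C (k : nat) := cos (th *+ 2 *+ k); pose E (k : nat) := sin (th *+ 2 *+ k) / sn.
have c2E : 2 * c ^+ 2 - 1 = c ^+ 2 - sn ^+ 2 by rewrite sc; ring.
have iterE k : iter k (simple_refl s \o simple_refl t) v =
    u + (x * (E k * c + C k) - y * E k) *: A
      + (x * E k - y * (E k * c - C k)) *: B.
  elim: k => [|k IHk].
    rewrite /E /C !mulr0n trigo.sin0 cos0 [LHS]vE.
    by apply/ffunP => i; rewrite !ffunE /GRing.scale /=; ring.
  rewrite iterS IHk step.
  have -> : E k.+1 = E k * (2 * c ^+ 2 - 1) + 2 * c * C k.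
    rewrite /E /C mulrSr sinD mulr2n sinD cosD -/c -/sn.
    by rewrite c2E; field.
  have -> : C k.+1 = C k * (2 * c ^+ 2 - 1) - 2 * c * (1 - c ^+ 2) * E k.
    rewrite /E /C mulrSr cosD mulr2n sinD cosD -/c -/sn.
    by rewrite c2E -sc; field.
  by apply/ffunP => i; rewrite !ffunE /GRing.scale /=; ring.
have thm : th *+ 2 *+ m = pi *+ 2.
  by rewrite -mulrnA mulnC mulrnA -[th *+ m]mulr_natr /th divfK.
rewrite iterE /E /C thm sin2pi cos2pi [RHS]vE.
by apply/ffunP => i; rewrite !ffunE /GRing.scale /=; ring.
Qed.

Lemma word_act_cat u w v : word_act (u ++ w) v = word_act u (word_act w v).
Proof. exact: foldr_cat. Qed.

Lemma word_act_equiv u w : word_equiv g u w -> word_act u =1 word_act w.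
Proof.
elim=> // {u w} [u w _ e v | u w z _ e1 _ e2 v | u w s t v].
- by rewrite e.
- by rewrite e1.
- rewrite !word_act_cat; congr word_act.
  rewrite -[RHS](dihedral_relation s t).
  by elim: (cox_m g s t) => //= k ->.
Qed.

Lemma geom_act_word u : geom_act (word_prod g u) = word_act u.
Proof.
apply/funext => v; rewrite /geom_act; apply: word_act_equiv.
have [_ _ _] := hcox; apply.
by have /= <- := @xgetPex _ [::] [set z | word_prod g u = word_prod g z]
  (ex_intro _ u erefl).
Qed.

Lemma geom_act1 v : geom_act 1%g v = v.
Proof. by rewrite -[1%g](big_nil _ _ _ _ : word_prod g [::] = _) geom_act_word. Qed.

Lemma geom_actM w w' v : geom_act (w * w')%g v = geom_act w (geom_act w' v).
Proof.
have [_ _ surj _] := hcox; have [[u ->] [u' ->]] := (surj w, surj w').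
by rewrite -big_cat -/(word_prod g (u ++ u')) !geom_act_word word_act_cat.
Qed.

Lemma geom_act_simple s v :
  geom_act (g s) v = v - (2 * bform (simple_root s) v) *: simple_root s.
Proof.
by rewrite -[g s](big_seq1 _ _ _ : word_prod g [:: s] = _) geom_act_word.
Qed.

End GeometricRepresentation.

(* Main.v *)
(* An element [w] is essential iff it fixes no nonzero linear form of the Tits
   cone: the stabilizers of the points of the cone are parabolic, and a proper
   parabolic subgroup fixes a translate of a coordinate form.  The Tits cone is
   taken to be the set of linear forms that are nonnegative on all but finitely
   many positive roots.  It is clearly convex, and it is pointed: if [x] and [-x]
   lie in it, then [x] vanishes on almost all roots; the forms with this property
   are a [W]-stable space, which by irreducibility contains all [<alpha_s, ->]
   unless it is zero, and then only finitely many roots, hence a finite [W],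
   remain.  So if [w^k] fixes [x != 0] in the cone, the sum of the [w^i x] for
   [i < k] is nonzero and fixed by [w], which gives (2); and (1) is (2) applied to
   [w^k = 1].

   For (3), suppose that [s_(c_1) ... s_(c_n)] lies in a conjugate of [W_I], and
   let [x] be a form vanishing on [I].  The maps
   [v |-> s v - 2 x(alpha_s) alpha_s] define an affine action of [W] on [V] in
   which [W_I] fixes 0, so the product fixes some [v].  As the [c_i] are
   independent, every factor fixes [v], that is, [<v, -> + x] vanishes on every
   [c_i], hence on [V].  The whole of [W] then fixes [v], which forces [x = 0].
   The affine action is needed because the form of [V] may be degenerate. *)
Require Import Defs.
From mathcomp Require Import all_boot all_order all_algebra.
From mathcomp Require Import all_classical all_reals.
From mathcomp Require Import trigo ring lra zify.

Set Implicit Arguments.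
Unset Strict Implicit.
Unset Printing Implicit Defensive.

Import Order.TTheory GRing.Theory Num.Theory.

Local Open Scope classical_set_scope.
Local Open Scope group_scope.

(** * Length and alternating words *)

Section Length.
Variables (W : groupType) (S : finType) (g : S -> W).
Hypothesis hcox : coxeter_system g.
Implicit Types (s t : S) (v w : W) (u : seq S).

Lemma word_prod_cat u u' : word_prod g (u ++ u') = word_prod g u * word_prod g u'.
Proof. exact: big_cat. Qed.

Lemma word_prod1 s : word_prod g [:: s] = g s.
Proof. exact: big_seq1. Qed.

Lemma word_prod_rcons u s : word_prod g (rcons u s) = word_prod g u * g s.
Proof. by rewrite -cats1 word_prod_cat word_prod1. Qed.

Lemma word_prod_surj w : exists u, w = word_prod g u.
Proof. by have [_ _ surj _] := hcox; exact: surj. Qed.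

Lemma gen_sq s : g s * g s = 1.
Proof. by have [_ /(_ s) o2 _ _] := hcox; rewrite -[RHS](@ordP _ (g s)) o2. Qed.

Lemma gen_inv s : (g s)^-1 = g s.
Proof. by apply/mulg1_eq/gen_sq. Qed.

Lemma word_prod_ind (P : W -> Prop) :
  P 1 -> (forall w s, P w -> P (w * g s)) -> forall w, P w.
Proof.
move=> P1 PM w; have [u ->] := word_prod_surj w.
elim/last_ind: u => [|u s IH]; first by rewrite /word_prod big_nil.
by rewrite word_prod_rcons; apply: PM.
Qed.

(** Relators have even length, so length modulo 2 is the sign character of [W]; it keeps [w] and
    [w * g s] from having equal length. *)
Lemma word_equiv_odd u u' : word_equiv g u u' -> odd (size u) = odd (size u').
Proof.
elim=> // [a b c _ -> _ -> //|a b s t].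
rewrite !size_cat !oddD.
have -> : odd (size (flatten (nseq (cox_m g s t) [:: s; t]))) = false.
  by elim: (cox_m g s t) => //= k ->.
by [].
Qed.

Lemma word_prod_odd u u' :
  word_prod g u = word_prod g u' -> odd (size u) = odd (size u').
Proof. by have [_ _ _ h] := hcox => /h/word_equiv_odd. Qed.

Lemma has_word_of_size w : exists n, `[< exists2 u, size u = n & w = word_prod g u >].
Proof. by have [u ->] := word_prod_surj w; exists (size u); apply/asboolP; exists u. Qed.

Definition len w : nat := ex_minn (has_word_of_size w).

Lemma reduced_word w : exists2 u, size u = len w & w = word_prod g u.
Proof. by rewrite /len; case: ex_minnP => n /asboolP. Qed.

Lemma len_le u w : w = word_prod g u -> len w <= size u.
Proof.
move=> wE; rewrite /len; case: ex_minnP => n _; apply.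
by apply/asboolP; exists u.
Qed.

Lemma len_odd u w : w = word_prod g u -> odd (len w) = odd (size u).
Proof.
have [u' <- ->] := reduced_word w; exact: word_prod_odd.
Qed.

Lemma len_mul_le w u : len (w * word_prod g u) <= len w + size u.
Proof.
have [z <- {1}->] := reduced_word w; rewrite -size_cat; apply: len_le.
by rewrite word_prod_cat.
Qed.

Lemma len_gen w s : len (w * g s) = (len w).+1 \/ len w = (len (w * g s)).+1.
Proof.
have le1 v : len (v * g s) <= (len v).+1.
  by rewrite -addn1 -word_prod1; apply: len_mul_le [:: s].
have := le1 (w * g s); rewrite -mulgA gen_sq mulg1 => h1.
have h2 := le1 w.
have : odd (len (w * g s)) = ~~ odd (len w).
  have [u su wE] := reduced_word w.
  rewrite (@len_odd (rcons u s)) ?size_rcons ?su //.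
  by rewrite word_prod_rcons -wE.
lia.
Qed.

Lemma len_descent w : w <> 1 -> exists s, len (w * g s) < len w.
Proof.
have [u + wE] := reduced_word w; case/lastP: u wE => [|u s] wE su.
  by move=> []; rewrite wE /word_prod big_nil.
move=> _; exists s; rewrite -su size_rcons ltnS; apply: len_le.
by rewrite wE word_prod_rcons -mulgA gen_sq mulg1.
Qed.

Fixpoint alt k s t : seq S := if k is k'.+1 then rcons (alt k' t s) t else [::].

Lemma size_alt k s t : size (alt k s t) = k.
Proof. by elim: k s t => //= k IH s t; rewrite size_rcons IH. Qed.

Lemma alt_cons k s t : alt k.+1 s t = (if odd k then s else t) :: alt k s t.
Proof.
elim: k s t => // k IH s t.
by rewrite /= -[rcons (alt k s t) s]/(alt k.+1 t s) IH /=; case: (odd k).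
Qed.

Lemma alt_suffix k m s t : exists2 b, size b = k & alt (k + m) s t = b ++ alt m s t.
Proof.
elim: k => [|k [b sb E]]; first by exists [::].
exists ((if odd (k + m) then s else t) :: b); first by rewrite /= sb.
by rewrite addSn alt_cons E.
Qed.

(** Inverting reverses a word in involutions, so the quotient is an alternating product of [2k]
    letters starting with [s]. At [k = m(s,t)] it is 1, which is the braid relation. *)
Lemma alt_quotient k s t :
  (word_prod g (alt k t s))^-1 * word_prod g (alt k s t) = (g s * g t) ^+ k.
Proof.
elim: k s t => [|k IH] s t; first by rewrite expg0 /word_prod big_nil mulVg.
rewrite /= !word_prod_rcons invgM gen_inv -mulgA [_^-1 * _]mulgA IH.
have swap : g s * (g t * g s) ^+ k = (g s * g t) ^+ k * g s.
  elim: k {IH} => [|k IH]; first by rewrite !expg0 mul1g mulg1.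
  by rewrite !expgS 2!mulgA -[_ * (_ ^+ k)]mulgA IH !mulgA.
by rewrite mulgA swap -mulgA -expgSr.
Qed.

Lemma alt_braid s t :
  word_prod g (alt (cox_m g s t) s t) = word_prod g (alt (cox_m g s t) t s).
Proof.
have := alt_quotient (cox_m g s t) s t.
case: (posnP (cox_m g s t)) => [-> //|m_gt0]; rewrite ordP // => /eqP.
by rewrite mulg_eq1 eqg_inv => /eqP.
Qed.

End Length.

(** * Positive and negative roots *)

Section Roots.
Variables (R : realType) (W : groupType) (S : finType) (g : S -> W).
Hypothesis hcox : coxeter_system g.
Local Open Scope ring_scope.
Local Notation V := (geom_space R S).
Local Notation act := (@geom_act R W S g).
Local Notation alpha := (@simple_root R S).
Local Notation B := (@bform R W S g).
Local Notation len := (len hcox).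
Implicit Types (s t : S) (w : W) (u v : V).

Lemma bformC u v : B u v = B v u.
Proof.
rewrite /bform exchange_big; apply: eq_bigr => s _; apply: eq_bigr => t _.
by rewrite (cox_formC R g) [u t * _]mulrC.
Qed.

Lemma bform_scalar u : scalar (B u : V -> R).
Proof. by move=> a v v'; rewrite bformDr bformZr. Qed.

Lemma bform_scalarl v : scalar (B^~ v : V -> R).
Proof. by move=> a u u'; rewrite ![B _ v]bformC bform_scalar. Qed.

Lemma bform_simple_diag s : B (alpha s) (alpha s) = 1.
Proof. by rewrite bform_simple /cox_form cox_m_diag // divr1 cospi opprK. Qed.

Lemma geom_act_linear w a u v : act w (a *: u + v) = a *: act w u + act w v.
Proof.
elim/(word_prod_ind hcox): w u v => [|w s IH] u v; first by rewrite !geom_act1.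
rewrite !(geom_actM hcox) -IH !(geom_act_simple hcox) bform_scalar; congr (act w _).
by apply/ffunP => i; rewrite !ffunE /GRing.scale /=; ring.
Qed.

Lemma geom_actZ w a v : act w (a *: v) = a *: act w v.
Proof.
have w0 : act w 0 = 0.
  by have := geom_act_linear w (-1) 0 0; rewrite scaler0 addr0 scaleN1r addNr.
by rewrite -[a *: v]addr0 geom_act_linear w0 addr0.
Qed.

Lemma geom_actD w u v : act w (u + v) = act w u + act w v.
Proof. by rewrite -[u]scale1r geom_act_linear !scale1r. Qed.

Lemma geom_actN w v : act w (- v) = - act w v.
Proof. by rewrite -scaleN1r geom_actZ scaleN1r. Qed.

Lemma geom_actK w : cancel (act w) (act w^-1%g).
Proof. by move=> v; rewrite -(geom_actM hcox) mulVg geom_act1. Qed.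

Lemma geom_actVK w : cancel (act w^-1%g) (act w).
Proof. by move=> v; rewrite -(geom_actM hcox) mulgV geom_act1. Qed.

Lemma geom_act_gen_simple s : act (g s) (alpha s) = - alpha s.
Proof.
rewrite (geom_act_simple hcox) bform_simple_diag.
by apply/ffunP => i; rewrite !ffunE /GRing.scale /=; ring.
Qed.

Lemma bform_act w u v : B (act w u) (act w v) = B u v.
Proof.
elim/(word_prod_ind hcox): w u v => [|w s IH] u v; first by rewrite !geom_act1.
rewrite !(geom_actM hcox) IH !(geom_act_simple hcox) -!scaleNr.
rewrite ![_ + (- _) *: _]addrC bform_scalar !bform_scalarl.
by rewrite bform_simple_diag [B u (alpha s)]bformC; ring.
Qed.

(** [E] abstracts [sin (k th) / sin th] for [c = cos th], and its limit [k] for [c = 1], so that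
    finite and infinite [m(s,t)] share one computation. *)
Lemma geom_act_alt_simple (E : nat -> R) s t c k :
    E 0%N = 0 -> E 1%N = 1 -> (forall j, E j.+2 = 2 * c * E j.+1 - E j) ->
    cox_form R g s t = - c ->
  act (word_prod g (alt k s t)) (alpha s) =
    E k.+1 *: alpha (if odd k then t else s) + E k *: alpha (if odd k then s else t).
Proof.
move=> E0 E1 ES.
have act_nil v : act (word_prod g [::]) v = v.
  by rewrite /word_prod big_nil geom_act1.
have step a s' t' : cox_form R g s' t' = - c ->
    act (a * g t')%g (alpha s') = act a (alpha s') + (2 * c) *: act a (alpha t').
  move=> st; rewrite (geom_actM hcox) (geom_act_simple hcox) bform_simple.
  by rewrite (cox_formC R g) st mulrN scaleNr opprK geom_actD geom_actZ.
(* Removing the last letter of [alt k.+2 s t] calls for length [k.+1] with [s] and [t] exchanged and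
   for length [k]. *)
suff P : (forall s t, cox_form R g s t = - c ->
  act (word_prod g (alt k s t)) (alpha s) =
    E k.+1 *: alpha (if odd k then t else s) + E k *: alpha (if odd k then s else t))
  /\ (forall s t, cox_form R g s t = - c ->
  act (word_prod g (alt k.+1 s t)) (alpha s) =
    E k.+2 *: alpha (if odd k then s else t) + E k.+1 *: alpha (if odd k then t else s)).
  by case: P => + _; exact.
elim: k {s t} => [|k [IH IH']]; split => s t st.
- by rewrite act_nil E0 E1 scale1r scale0r addr0.
- rewrite word_prod_rcons step // !act_nil ES E0 E1 subr0 mulr1 scale1r.
  exact: addrC.
- by rewrite IH' //=; case: (odd k).
- rewrite [alt k.+2 s t]/= word_prod_rcons step // -[rcons _ s]/(alt k.+1 t s).
  rewrite IH' 1?(cox_formC R g) //= word_prod_rcons geom_actM //.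
  rewrite geom_act_gen_simple geom_actN IH // (ES k.+1) (ES k).
  by case: (odd k); apply/ffunP => i; rewrite !ffunE /GRing.scale /=; ring.
Qed.

Definition nonneg v := forall i, 0 <= v i.

Lemma nonneg_simple s : nonneg (alpha s).
Proof. by move=> i; rewrite ffunE. Qed.

Lemma nonneg_comb a b u v : 0 <= a -> 0 <= b -> nonneg u -> nonneg v ->
  nonneg (a *: u + b *: v).
Proof. by move=> a0 b0 u0 v0 i; rewrite !ffunE addr_ge0 // mulr_ge0. Qed.

Lemma sin_cox_gt0 s t : s != t -> cox_m g s t != 0%N -> 0 < sin (pi / (cox_m g s t)%:R : R).
Proof.
move=> st; set m := cox_m g s t => m_neq0.
have m_neq1 : m != 1%N by apply: contra_neq st => /(cox_m_eq1 hcox).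
have m_gt1 : (1 < m)%N by case: (m) m_neq0 m_neq1 => [|[]].
have mR : (0 : R) < m%:R by rewrite ltr0n lt0n.
apply: sin_gt0_pi; rewrite divr_gt0 ?pi_gt0 //=.
by rewrite ltr_pdivrMr // ltr_pMr ?pi_gt0 // ltr1n.
Qed.

(** The coefficients are [sin (j th) / sin th] with [th = pi / m] and [j <= m], so the angle stays
    within [[0, pi]]; for infinite order they are the integers [j]. *)
Lemma geom_act_alt_nonneg s t k : s != t ->
    (cox_m g s t == 0%N) || (k < cox_m g s t)%N ->
  exists a b, [/\ 0 <= a, 0 <= b &
    act (word_prod g (alt k s t)) (alpha s) = a *: alpha s + b *: alpha t].
Proof.
move=> st hk.
suff [E [Ek Ek1 ->]] : exists E : nat -> R, [/\ 0 <= E k, 0 <= E k.+1 &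
    act (word_prod g (alt k s t)) (alpha s) =
    E k.+1 *: alpha (if odd k then t else s) + E k *: alpha (if odd k then s else t)].
  case: (odd k); last by exists (E k.+1), (E k).
  by exists (E k), (E k.+1); split=> //; rewrite addrC.
have [m0|m_neq0] := eqVneq (cox_m g s t) 0%N.
  exists (fun k => k%:R); split; rewrite ?ler0n //.
  apply: (@geom_act_alt_simple _ _ _ 1) => // [j|].
    by rewrite -!natr1; ring.
  by rewrite /cox_form m0.
set m := cox_m g s t in hk m_neq0.
have mR : (0 : R) < m%:R by rewrite ltr0n lt0n.
pose th : R := pi / m%:R.
have th_ge0 : 0 <= th by rewrite divr_ge0 ?pi_ge0 // ltW.
have sin_gt0 : 0 < sin th by apply: sin_cox_gt0.
have E_ge0 j : (j <= m)%N -> 0 <= sin (th *+ j) / sin th.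
  move=> jm; rewrite divr_ge0 ?(ltW sin_gt0) // sin_ge0_pi // mulrn_wge0 //=.
  rewrite -mulr_natr /th mulrAC ler_pdivrMr // ler_pM2l ?pi_gt0 //.
  by rewrite ler_nat.
rewrite (negPf m_neq0) /= in hk.
exists (fun j => sin (th *+ j) / sin th); split; rewrite ?E_ge0 // 1?ltnW //.
apply: (@geom_act_alt_simple (fun j => sin (th *+ j) / sin th) _ _ (cos th)) => [||j|].
- by rewrite mulr0n sin0 mul0r.
- by rewrite divff // gt_eqF.
- rewrite -[RHS]opprK opprB mulrA -mulrBl -mulNr; congr (_ / _).
  rewrite !mulrSr sinD cosD sinD.
  set x := sin (th *+ j); set y := cos (th *+ j).
  have e : sin th * sin th = 1 - cos th * cos th by rewrite -!expr2 sin2cos2.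
  transitivity (2 * cos th * (x * cos th + y * sin th)
    - x * (cos th * cos th) - x * (sin th * sin th)).
    by ring.
  by rewrite e; ring.
- by rewrite /cox_form -/m (negPf m_neq0).
Qed.

(* Write [w = v a] with [len w = len v + k], where [a] is alternating in [s] and
   [t] of the largest possible length [k].  Then [v s] and [v t] are longer than
   [v], so induction applies to [v], and [a] maps [alpha s] to a nonnegative
   combination of [alpha s] and [alpha t]. *)
Lemma ascent_nonneg w s : (len w < len (w * g s)%g)%N -> nonneg (act w (alpha s)).
Proof.
have [n] := ubnP (len w); elim: n w s => // n IH w s; rewrite ltnS => wn ws.
have [->|w1] := pselect (w = 1%g).
  by rewrite geom_act1 //; exact: nonneg_simple.
have [t wt] := len_descent hcox w1.
have st : s != t by apply: contraTneq ws => ->; rewrite -leqNgt ltnW.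
pose P k := `[< exists v : W, w = (v * word_prod g (alt k s t))%g /\ len w = (len v + k)%N >].
have P1 : P 1%N.
  apply/asboolP; exists (w * g t)%g; split.
    by rewrite word_prod1 -mulgA gen_sq // mulg1.
  by case: (len_gen hcox w t); lia.
have Pbound k : P k -> (k <= len w)%N by move=> /asboolP[v [_ ->]]; rewrite leq_addl.
case: (ex_maxnP (ex_intro P 1%N P1) Pbound) => k /asboolP[v [wE lE]] kmax.
have k_gt0 := kmax _ P1.
have up x : x = s \/ x = t -> (len v < len (v * g x)%g)%N.
  move=> hx; case: (len_gen hcox v x) => [->//|lv].
  have vE : v = (v * g x * g x)%g by rewrite -mulgA gen_sq // mulg1.
  have cons_prod y : word_prod g (x :: y) = (g x * word_prod g y)%g.
    by rewrite -cat1s word_prod_cat word_prod1.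
  (* If [x] prolongs the alternating word on the left, [k] was not maximal. Otherwise [x] is its
     first letter and is absorbed into [v], which makes [w] too short. *)
  have [xE|xE] := eqVneq x (if odd k then s else t).
    suff /kmax : P k.+1 by rewrite ltnn.
    apply/asboolP; exists (v * g x)%g; rewrite alt_cons -xE cons_prod mulgA -vE.
    by split=> //; rewrite lE lv addSnnS.
  case: k lE k_gt0 {kmax} wE xE => // k lE _ wE xE.
  have {}xE : x = if odd k then s else t.
    by move: xE => /=; case: hx => ->; case: (odd k); rewrite ?eqxx.
  have : (len w <= len (v * g x)%g + k)%N.
    by rewrite wE alt_cons -xE cons_prod mulgA -{2}(size_alt k s t) len_mul_le.
  lia.
(* If [k >= m], the braid relation makes the final [m] letters end in [s], and [w * g s] would be
   shorter than [w]. *)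
have km : (cox_m g s t == 0%N) || (k < cox_m g s t)%N.
  have := alt_braid hcox s t; case: (cox_m g s t) => // m braid /=.
  rewrite ltnNge; apply/negP => mk.
  have [b sb altE] := alt_suffix (k - m.+1) m.+1 s t.
  have : (len (w * g s)%g <= len v + (k - m.+1 + m))%N.
    suff -> : (w * g s = v * word_prod g (b ++ alt m s t))%g.
      by rewrite -[X in (_ <= _ + X)%N](_ : size (b ++ alt m s t) = _) ?len_mul_le //
           size_cat sb size_alt.
    rewrite wE -mulgA -(subnK mk) altE !word_prod_cat braid /= word_prod_rcons.
    by rewrite -!mulgA gen_sq // mulg1.
  lia.
have [a [b [a0 b0 E]]] := geom_act_alt_nonneg st km.
rewrite {1}wE geom_actM // E geom_actD // !geom_actZ //.
by apply: nonneg_comb => //; apply: IH; [lia|apply: up; left|lia|apply: up; right].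
Qed.

Local Notation root := (@root_system R W S g).

Lemma root_act w v : root v -> root (act w v).
Proof. by move=> [w' [s ->]]; exists (w * w')%g, s; rewrite geom_actM. Qed.

Lemma root_simple s : root (alpha s).
Proof. by exists 1%g, s; rewrite geom_act1. Qed.

Lemma bform_root v : root v -> B v v = 1.
Proof. by move=> [w [s ->]]; rewrite bform_act // bform_simple_diag. Qed.

Lemma descent_nonpos w s : (len (w * g s)%g < len w)%N -> nonneg (- act w (alpha s)).
Proof.
move=> ws; rewrite -geom_actN // -geom_act_gen_simple // -geom_actM //.
by apply: ascent_nonneg; rewrite -mulgA gen_sq // mulg1.
Qed.

Lemma root_dichotomy v : root v -> nonneg v \/ nonneg (- v).
Proof.
move=> [w [s ->]]; case: (len_gen hcox w s) => l.
  by left; apply: ascent_nonneg; rewrite l.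
by right; apply: descent_nonpos; rewrite l.
Qed.

Lemma not_nonneg_opp v : root v -> nonneg v -> ~ nonneg (- v).
Proof.
move=> /bform_root rv v0 v0'.
suff v_eq0 : v = 0.
  move: rv; rewrite v_eq0 -{2}(scale0r (0 : V)) bformZr mul0r => /esym/eqP.
  by rewrite oner_eq0.
apply/ffunP => i; apply/eqP; rewrite ffunE eq_le v0.
by have := v0' i; rewrite ffunE oppr_ge0 => ->.
Qed.

Lemma geom_act_gen_coord s t v : t != s -> act (g s) v t = v t.
Proof.
by move=> /negPf ts; rewrite geom_act_simple // !ffunE ts /GRing.scale /= mulr0 subr0.
Qed.

(** Only the coordinate at [s] changes. If the image were negative, all other coordinates of [v]
    would vanish, and norm 1 then leaves only [alpha s]. *)
Lemma geom_act_gen_nonneg s v :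
  root v -> nonneg v -> v <> alpha s -> nonneg (act (g s) v).
Proof.
move=> rv v0 vs; case: (root_dichotomy (root_act (g s) rv)) => // neg; case: vs.
have vE : v = v s *: alpha s.
  apply/ffunP => t; rewrite !ffunE /GRing.scale /=.
  case: eqVneq => [->|ts]; first by rewrite mulr1.
  rewrite mulr0; apply/eqP; rewrite eq_le v0 andbT.
  by have := neg t; rewrite ffunE geom_act_gen_coord // oppr_ge0.
have := bform_root rv; rewrite {1 2}vE.
have BZ a b : B (a *: alpha s) (b *: alpha s) = a * b.
  by rewrite bformZr bformC bformZr bform_simple_diag // mulr1 mulrC.
rewrite BZ -expr2 => /eqP; rewrite sqrf_eq1 => /orP[] /eqP vs1.
  by rewrite vE vs1 scale1r.
by have := v0 s; rewrite vs1 oppr_ge0 ler10.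
Qed.

(** A positive root inverted by [w * g s] is [alpha s] or the image under [s] of one inverted by
    [w]. *)
Lemma finite_inversions w : exists l : seq V,
  forall v, root v -> nonneg v -> nonneg (- act w v) -> v \in l.
Proof.
elim/(word_prod_ind hcox): w => [|w s [l hl]].
  by exists [::] => v rv v0; rewrite geom_act1 // => /(not_nonneg_opp rv v0).
exists (alpha s :: map (act (g s)) l) => v rv v0 neg; rewrite inE; apply/orP.
have [->|vs] := eqVneq v (alpha s); [by left|right].
have vE : v = act (g s) (act (g s) v) by rewrite -geom_actM // gen_sq // geom_act1.
rewrite vE; apply: map_f; apply: hl.
- exact: root_act.
- by apply: geom_act_gen_nonneg => //; apply/eqP.
- by rewrite -geom_actM.
Qed.

(** * The Tits cone *)

Implicit Types (x y : V -> R).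

Lemma scalar0 x : scalar x -> x 0 = 0.
Proof. by move=> xlin; have := xlin 1 0 0; rewrite scaler0 addr0; lra. Qed.

Lemma scalarN x v : scalar x -> x (- v) = - x v.
Proof.
move=> xlin; have := xlin (-1) v 0.
by rewrite addr0 scaleN1r scalar0 // addr0 mulN1r.
Qed.

Lemma simple_root_basis v : v = \sum_s v s *: alpha s.
Proof.
apply/ffunP => t; rewrite sum_ffunE (bigD1 t) //= big1 ?addr0 => [|s /negPf st].
  by rewrite !ffunE eqxx /GRing.scale /= mulr1.
by rewrite !ffunE eq_sym st /GRing.scale /= mulr0.
Qed.

Lemma scalar_expand x v : scalar x -> x v = \sum_s v s * x (alpha s).
Proof.
move=> xlin; rewrite {1}[v]simple_root_basis.
have x0 := scalar0 xlin; elim/big_rec2: _ => // s a u _ <-.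
exact: xlin.
Qed.

Lemma scalar_act x w : scalar x -> scalar (x \o act w).
Proof. by move=> xlin a u v; rewrite /= geom_act_linear xlin. Qed.

Definition tits_cone x := scalar x /\
  exists l : seq V, forall v, root v -> nonneg v -> x v < 0 -> v \in l.

Lemma tits_cone_act x w : tits_cone x -> tits_cone (x \o act w).
Proof.
move=> [xlin [l hl]]; split; first exact: scalar_act.
have [l' hl'] := finite_inversions w.
exists (map (act w^-1%g) l ++ l') => v rv v0 xv; rewrite mem_cat; apply/orP.
case: (root_dichotomy (root_act w rv)) => wv; [left|right; exact: hl'].
by rewrite -(geom_actK w v) map_f // hl //; exact: root_act.
Qed.

Lemma tits_coneD x y : tits_cone x -> tits_cone y -> tits_cone (fun v => x v + y v).
Proof.
move=> [xlin [l hl]] [ylin [l' hl']]; split; first by move=> a u v; rewrite xlin ylin; ring.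
exists (l ++ l') => v rv v0 xyv; rewrite mem_cat; apply/orP.
have [xv|xv] := ltP (x v) 0; [left; exact: hl|right].
by apply: hl' => //; lra.
Qed.

(* If [x (alpha s) < 0], then composing [x] with [s] removes [alpha s] from the
   finite set of positive roots at which [x] is negative. *)
Lemma tits_cone_chamber x : tits_cone x -> exists w, forall s, 0 <= x (act w (alpha s)).
Proof.
move=> [xlin [l]]; have [n] := ubnP (size l).
elim: n l x xlin => // n IH l x xlin; rewrite ltnS => ln hl.
have [dom|] := pselect (forall s, 0 <= x (alpha s)).
  by exists 1%g => s; rewrite geom_act1.
move=> /existsNP[s /negP]; rewrite -ltNge => xs.
have gK v : act (g s) (act (g s) v) = v by rewrite -geom_actM // gen_sq // geom_act1.
pose l' := map (act (g s)) [seq v <- l | v != alpha s].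
have [||w hw] := IH l' (x \o act (g s)) (scalar_act _ xlin).
- rewrite size_map size_filter; apply: leq_trans ln.
  rewrite -(count_predC (fun v => v != alpha s) l) -[X in (X < _)%N]addn0 ltn_add2l -has_count.
  apply/hasP; exists (alpha s); last by rewrite /= negbK.
  by apply: hl => //; [exact: root_simple|exact: nonneg_simple].
- move=> v rv v0 /= xv; rewrite -(gK v); apply: map_f; rewrite mem_filter /=.
  apply/andP; split.
    apply/eqP => vE; apply: (not_nonneg_opp (root_simple s) (@nonneg_simple s)).
    by rewrite -geom_act_gen_simple -vE gK.
  apply: hl => //; first exact: root_act.
  apply: geom_act_gen_nonneg => // vE.
  by move: xv; rewrite vE geom_act_gen_simple scalarN // oppr_lt0 => /(lt_trans xs); rewrite ltxx.
by exists (g s * w)%g => t; rewrite geom_actM // hw.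
Qed.

(** * Parabolic subgroups as stabilizers *)

Lemma subgroup_generated (A : set W) : subgroup (generated A).
Proof.
have memE (H : set W) w : (w \in mem H) = `[< H w >] by [].
split; first by apply/asboolP => H [[+ _] _] => /asboolP.
move=> a b /asboolP aA /asboolP bA; apply/asboolP => H HA.
have [[_ Hdiv] _] := HA.
by apply/asboolP/Hdiv; apply/asboolP; [apply: aA|apply: bA].
Qed.

Lemma generatedM (A : set W) a b : generated A a -> generated A b -> generated A (a * b)%g.
Proof.
move=> /asboolP aA /asboolP bA; apply/asboolP.
exact: (group_closedM (subgroup_generated A)).
Qed.

(** At a right descent [s] of [w], [x (act w (alpha s))] is nonpositive, yet equal to
    [x (alpha s) >= 0]. So [s] fixes [x], and induction applies to the shorter [w * g s]. *)
Lemma stabilizer_standard x w : scalar x -> (forall s, 0 <= x (alpha s)) ->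
  (forall v, x (act w v) = x v) -> standard_parabolic g [set s | x (alpha s) = 0] w.
Proof.
move=> xlin dom; have [n] := ubnP (len w).
elim: n w => // n IH w; rewrite ltnS => wn fix_w.
have [->|w1] := pselect (w = 1%g).
  by have [/asboolP] := subgroup_generated (g @` [set s | x (alpha s) = 0]).
have [s ws] := len_descent hcox w1.
have xs0 : x (alpha s) = 0.
  apply/eqP; rewrite eq_le dom andbT -fix_w -oppr_ge0 -scalarN //.
  rewrite scalar_expand //; apply: sumr_ge0 => t _.
  by rewrite mulr_ge0 //; apply: descent_nonpos.
rewrite -[w]mulg1 -(gen_sq hcox s) mulgA; apply: generatedM.
  apply: IH => [|v]; first exact: leq_trans ws wn.
  rewrite geom_actM // fix_w geom_act_simple // -scaleNr addrC xlin xs0; ring.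
by apply: sub_gen_smallest; exists s.
Qed.

Lemma standard_parabolic_fix x (I : set S) w : scalar x ->
  (forall s, I s -> x (alpha s) = 0) -> standard_parabolic g I w ->
  forall v, x (act w v) = x v.
Proof.
move=> xlin xI wI; pose H := [set w | forall v, x (act w v) = x v].
have memH a : (a \in mem H) = `[< H a >] by [].
apply: (smallest_sub (X := H) _ _ wI).
- split; first by apply/asboolP => v; rewrite geom_act1.
  move=> a b /asboolP aH /asboolP bH; apply/asboolP => v.
  by rewrite geom_actM // aH -bH geom_actVK.
- move=> _ [s /xI xs <-] v; rewrite geom_act_simple // -scaleNr addrC xlin xs; ring.
Qed.

Lemma scalar_eq0 x : scalar x -> (forall s, x (alpha s) = 0) -> forall v, x v = 0.
Proof. by move=> xlin x0 v; rewrite scalar_expand // big1 // => s _; rewrite x0 mulr0. Qed.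

Lemma coord_tits_cone s : tits_cone (fun v => v s).
Proof.
split; first by move=> a u v; rewrite !ffunE.
by exists [::] => v _ v0; rewrite ltNge v0.
Qed.

Lemma standard_parabolicT w : standard_parabolic g setT w.
Proof.
elim/(word_prod_ind hcox): w => [|w s IH].
  by have [/asboolP] := subgroup_generated (g @` setT).
by apply: generatedM => //; apply: sub_gen_smallest; exists s.
Qed.

Lemma not_proper_essential w :
    (forall (u : W) (I : set S) s, ~ I s -> ~ conjugate u (standard_parabolic g I) w) ->
  essential g w.
Proof.
move=> notin; have proper Q : parabolic g Q -> Q w -> Q = setT.
  move=> [u [I ->]] wQ.
  have [IT|/existsNP[s Is]] := pselect (forall s, I s); last by case: (notin u I s Is).
  have -> : I = setT by apply/seteqP; split.
  apply/seteqP; split=> // z _; exists (u^-1 * z * u)%g; first exact: standard_parabolicT.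
  by rewrite !mulgA mulgV mul1g mulgK.
split; last by move=> Q [Qp Qw _]; exact: proper.
split=> //; last by move=> Q Qp Qw _; exact: proper.
exists 1%g, setT; apply/seteqP; split=> // z _.
by exists z; [exact: standard_parabolicT|rewrite invg1 mulg1 mul1g].
Qed.

Lemma essentialP w : essential g w <->
  forall x, tits_cone x -> (forall v, x (act w v) = x v) -> forall v, x v = 0.
Proof.
split=> [[[_ _ wmin] _] x xU xw v|noU].
  have [u dom] := tits_cone_chamber xU.
  have ylin : scalar (x \o act u) by apply: scalar_act; case: xU.
  have yw v' : (x \o act u) (act (u^-1 * w * u)%g v') = (x \o act u) v'.
    by rewrite /= !geom_actM // geom_actVK xw.
  set I := [set s | (x \o act u) (alpha s) = 0].
  have PT : conjugate u (standard_parabolic g I) = setT.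
    apply: wmin => //; first by exists u, I.
    by exists (u^-1 * w * u)%g; [exact: stabilizer_standard|rewrite !mulgA mulgV mul1g mulgK].
  rewrite -(geom_actVK u v); apply: (scalar_eq0 ylin) => s.
  (* Each [g s] thus lies in [W_I] and fixes [x \o act u], whose value at [alpha s] is therefore its
     own opposite. *)
  have : conjugate u (standard_parabolic g I) (u * g s * u^-1)%g by rewrite PT.
  case=> h hI /mulIg/mulgI hE; move: hI; rewrite hE => hI.
  have := standard_parabolic_fix ylin (fun s (Is : I s) => Is) hI (alpha s).
  by rewrite geom_act_gen_simple scalarN //; lra.
apply: not_proper_essential => u I s Is [h hI hE].
have [clin _] := coord_tits_cone s.
have hfix v : (act u^-1%g (act w v)) s = (act u^-1%g v) s.
  rewrite -hE /= !geom_actM // geom_actK.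
  apply: (standard_parabolic_fix clin _ hI) => t It.
  by rewrite ffunE; case: eqVneq => // st; case: Is; rewrite st.
have := noU _ (tits_cone_act u^-1%g (coord_tits_cone s)) hfix (act u (alpha s)).
by rewrite /= geom_actK ffunE eqxx => /eqP; rewrite oner_eq0.
Qed.

(** A nontrivial [w] has a descent [s], and then [act w (alpha s)] is negative, unlike [alpha s]. *)
Lemma geom_act_faithful w : (forall s, act w (alpha s) = alpha s) -> w = 1%g.
Proof.
move=> fix_w; apply: contrapT => /(len_descent hcox)[s /descent_nonpos].
rewrite fix_w; apply: not_nonneg_opp; [exact: root_simple|exact: nonneg_simple].
Qed.

Lemma finite_roots (l : seq V) : (forall v, root v -> v \in l) -> finite_set [set: W].
Proof.
(* [w] is recorded by the positions in [l] of the images of the simple roots; [inord] needs a bound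
   of successor form. *)
move=> hl; pose F w := [ffun s => inord (index (act w (alpha s)) l) : 'I_(size l).+1].
have rw w s : root (act w (alpha s)) by exists w, s.
suff Finj : injective F.
  have := @finite_preimage _ _ setT F; apply; last exact: finite_finset.
  by move=> ? ? _ _; exact: Finj.
move=> w w' /ffunP FE; apply: (mulgI w'^-1%g); rewrite mulVg; apply: geom_act_faithful => s.
rewrite geom_actM //; have := FE s; rewrite !ffunE => /(congr1 (@nat_of_ord _)).
rewrite !inordK ?ltnS ?index_size // => /(congr1 (nth 0 l)).
by rewrite !nth_index ?hl // => ->; rewrite geom_actK.
Qed.

(** * Pointedness of the cone and powers of essential elements *)

Section Irreducible.
Hypothesis hinf : infinite_set [set: W].
Hypothesis hirr : irreducible_system g.

Let almost_null x := exists l : seq V, forall v, root v -> x v <> 0 -> v \in l.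

(** The form [x \o act (g s)] differs from [x] by a nonzero multiple of [B (alpha s)], so a root
    killed by both is orthogonal to [alpha s]. *)
Lemma almost_null_form x s : scalar x -> almost_null x -> x (alpha s) != 0 ->
  almost_null (B (alpha s)).
Proof.
move=> xlin [l hl] xs; exists (l ++ map (act (g s)) l) => v rv Bv.
rewrite mem_cat; apply/orP; have [xv|/eqP xv] := eqVneq (x v) 0; last by left; apply: hl.
right; have gK v' : act (g s) (act (g s) v') = v' by rewrite -geom_actM // gen_sq // geom_act1.
rewrite -(gK v); apply/map_f/hl; first exact: root_act.
rewrite geom_act_simple // -scaleNr addrC xlin xv addr0 => /eqP.
by rewrite mulf_eq0 oppr_eq0 mulf_eq0 pnatr_eq0 /= (negPf xs) orbF; apply/negP/eqP.
Qed.

Lemma cox_form_neq0 s t : cox_graph g s t -> cox_form R g s t != 0.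
Proof.
rewrite /cox_graph /= /cox_form; case: eqP => [_ _|_ /= m3]; first by rewrite oppr_eq0 oner_eq0.
rewrite oppr_eq0 gt_eqF // cos_gt0_pihalf //.
have m0 : (0 : R) < (cox_m g s t)%:R by rewrite ltr0n; lia.
apply/andP; split.
  by apply: lt_trans (divr_gt0 (pi_gt0 R) m0); rewrite oppr_lt0 divr_gt0 ?pi_gt0.
by rewrite ltr_pM2l ?pi_gt0 // ltf_pV2 ?posrE // ltr_nat.
Qed.

Lemma almost_null_eq0 x : scalar x -> almost_null x -> forall v, x v = 0.
Proof.
move=> xlin nx; apply: (scalar_eq0 xlin) => s; apply: contrapT => /eqP xs.
apply: hinf; have {xs} := almost_null_form xlin nx xs => ns.
(* [B (alpha s)] is nonzero at the neighbours of [s] in the Coxeter graph, so the property spreads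
   along paths. *)
have nullB t : almost_null (B (alpha t)).
  have /connectP[p + ->] := hirr s t; elim: p s ns => //= t' p IH s ns /andP[st' /IH]; apply.
  apply: (almost_null_form (bform_scalar (alpha s)) ns).
  by rewrite bform_simple cox_form_neq0.
have [l hl] := choice nullB.
(* A root outside all the lists would be orthogonal to every simple root, hence to itself, against
   its norm 1. *)
apply: (@finite_roots (flatten [seq l t | t <- enum S])) => v rv.
apply: contrapT => vl; have := bform_root rv.
suff Bv t : B (alpha t) v = 0.
  by rewrite (scalar_eq0 (bform_scalarl v) Bv) => /esym/eqP; rewrite oner_eq0.
apply: contrapT => /(hl t v rv) vlt; apply: vl.
by apply/flatten_mapP; exists t => //; rewrite mem_enum.
Qed.

Lemma tits_cone_pointed x y :
  tits_cone x -> tits_cone y -> (forall v, x v + y v = 0) -> forall v, x v = 0.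
Proof.
move=> [xlin [l hl]] [ylin [l' hl']] xy; apply: almost_null_eq0 => //.
have pos v : root v -> nonneg v -> x v <> 0 -> v \in l ++ l'.
  move=> rv v0 /eqP; rewrite neq_lt mem_cat => /orP[xv|xv]; first by rewrite hl.
  by rewrite hl' ?orbT //; have := xy v; lra.
exists ((l ++ l') ++ map -%R (l ++ l')) => v rv xv; rewrite mem_cat; apply/orP.
case: (root_dichotomy rv) => v0; [left; exact: pos|right].
rewrite -(opprK v); apply/map_f/pos => //; last by rewrite scalarN //; lra.
case: rv => w [s ->]; rewrite -geom_actN -geom_act_gen_simple -geom_actM //.
by exists (w * g s)%g, s.
Qed.

Lemma tits_cone_sum (n : nat) (F : nat -> V -> R) :
  (forall i, tits_cone (F i)) -> tits_cone (fun v => \sum_(i < n) F i v).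
Proof.
move=> FU; elim: n => [|n IH].
  under eq_fun do rewrite big_ord0.
  by split; [move=> a u v; rewrite mulr0 addr0|exists [::] => v _ _; rewrite ltxx].
under eq_fun do rewrite big_ord_recr.
exact: tits_coneD.
Qed.

Lemma essential_expgS w n : essential g w -> essential g (w ^+ n.+1)%g.
Proof.
rewrite !essentialP => ess x xU xw.
pose F i := x \o act (w ^+ i)%g.
have FU i : tits_cone (F i) by apply: tits_cone_act.
(* The term [i = 0] is split off: once the full sum vanishes, [x] and the remaining sum are opposite
   points of the cone. *)
apply: (tits_cone_pointed xU (tits_cone_sum n (fun i => FU i.+1))).
have sumE v : x v + \sum_(i < n) F i.+1 v = \sum_(i < n.+1) F i v.
  by rewrite big_ord_recl /F /= expg0 geom_act1.
move=> v; rewrite sumE; apply: (ess _ (tits_cone_sum n.+1 FU)).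
move=> {}v; rewrite -(sumE v) addrC.
(* [w] shifts the index, and the last term wraps around because [w ^+ n.+1] fixes [x]. *)
transitivity (\sum_(i < n.+1) F i.+1 v); last by rewrite big_ord_recr /= [in X in _ + X]/F /= xw.
by apply: eq_bigr => i _; rewrite /F /= -geom_actM // -expgSr.
Qed.

Lemma essential_of_expg w n : essential g (w ^+ n)%g -> essential g w.
Proof.
rewrite !essentialP => ess x xU xw; apply: ess => //.
by elim: n => [|n IH] v; rewrite ?expg0 ?geom_act1 // expgSr geom_actM // IH xw.
Qed.

Lemma essential_inv w : essential g w -> essential g w^-1%g.
Proof.
rewrite !essentialP => ess x xU xw; apply: ess => // v.
by rewrite -{2}(geom_actK w v) xw.
Qed.

(** The identity fixes every coordinate form, and there is one: an empty [S] would make [W]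
    trivial. *)
Lemma not_essential1 : ~ essential g 1%g.
Proof.
rewrite essentialP => ess; have [s _] : exists s : S, True.
  apply: contrapT => noS; apply: hinf; apply: (@sub_finite_set _ _ [set 1%g]) => // w _.
  by apply: geom_act_faithful => s; case: noS; exists s.
have := ess _ (coord_tits_cone s) (fun v => congr1 (fun u : V => u s) (geom_act1 hcox v)).
by move=> /(_ (alpha s)) /eqP; rewrite ffunE eqxx oner_eq0.
Qed.

End Irreducible.

(** * The affine action attached to a linear form *)

Section Affine.
Variable x : V -> R.
Hypothesis xlin : scalar x.

Definition affine_refl s v : V := v - (2 * (B (alpha s) v + x (alpha s))) *: alpha s.

Definition affine_word (l : seq S) v : V := foldr affine_refl v l.

(* The simple roots of a finite dihedral parabolic span a nondegenerate plane, so
   its two affine reflections have a common fixed point and are translates of the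
   linear ones. *)
Lemma affine_dihedral s t v :
  iter (cox_m g s t) (affine_refl s \o affine_refl t) v = v.
Proof.
have [m0|m_neq0] := eqVneq (cox_m g s t) 0%N; first by rewrite m0.
suff [z zs zt] : exists2 z, B (alpha s) z = - x (alpha s) & B (alpha t) z = - x (alpha t).
  have shift i u : B (alpha i) z = - x (alpha i) ->
      affine_refl i (u + z) = simple_refl g i u + z.
    move=> zi; rewrite /affine_refl /simple_refl bformDr zi.
    by apply/ffunP => k; rewrite !ffunE /GRing.scale /=; ring.
  rewrite -{1}(subrK z v).
  transitivity (iter (cox_m g s t) (simple_refl g s \o simple_refl g t) (v - z) + z).
    by elim: (cox_m g s t) => //= k ->; rewrite (shift _ _ zt) (shift _ _ zs).
  by rewrite dihedral_relation // subrK.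
have [<-|st] := eqVneq s t.
  by exists (- x (alpha s) *: alpha s); rewrite bformZr bform_simple_diag mulr1.
set b := B (alpha s) (alpha t).
have b2 : 1 - b * b != 0.
  rewrite /b bform_simple /cox_form (negPf m_neq0) mulrNN -expr2 -sin2cos2.
  by rewrite expf_neq0 // gt_eqF // sin_cox_gt0.
pose xs := x (alpha s); pose xt := x (alpha t).
exists (((b * xt - xs) / (1 - b * b)) *: alpha s + ((b * xs - xt) / (1 - b * b)) *: alpha t).
  by rewrite bformDr !bformZr bform_simple_diag -/b -/xs; field.
by rewrite bformDr !bformZr bform_simple_diag bformC -/b -/xt; field.
Qed.

Lemma affine_word_cat l l' v : affine_word (l ++ l') v = affine_word l (affine_word l' v).
Proof. exact: foldr_cat. Qed.

Lemma affine_word_equiv l l' : word_equiv g l l' -> affine_word l =1 affine_word l'.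
Proof.
elim=> // {l l'} [u w _ e v | u w z _ e1 _ e2 v | u w s t v]; rewrite ?e ?e1 //.
rewrite !affine_word_cat; congr affine_word.
rewrite -[RHS](affine_dihedral s t).
elim: (cox_m g s t) => [//|k IHk].
exact: (congr1 (affine_refl s \o affine_refl t) IHk).
Qed.

Definition affine_act w : V -> V := affine_word (sval (cid (word_prod_surj hcox w))).

Lemma affine_act_word l : affine_act (word_prod g l) = affine_word l.
Proof.
apply/funext => v; apply: affine_word_equiv; have [_ _ _ pres] := hcox; apply: pres.
by rewrite /sval; case: cid.
Qed.

Lemma affine_act1 v : affine_act 1%g v = v.
Proof. by rewrite -[1%g](big_nil _ _ _ _ : word_prod g [::] = _) affine_act_word. Qed.

Lemma affine_actM w w' v : affine_act (w * w')%g v = affine_act w (affine_act w' v).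
Proof.
have [[l ->] [l' ->]] := (word_prod_surj hcox w, word_prod_surj hcox w').
by rewrite -word_prod_cat !affine_act_word affine_word_cat.
Qed.

Lemma affine_act_gen s v : affine_act (g s) v = affine_refl s v.
Proof. by rewrite -word_prod1 affine_act_word. Qed.

Lemma affine_actVK w v : affine_act w (affine_act w^-1%g v) = v.
Proof. by rewrite -affine_actM mulgV affine_act1. Qed.

Lemma affine_actK w v : affine_act w^-1%g (affine_act w v) = v.
Proof. by rewrite -affine_actM mulVg affine_act1. Qed.

Lemma affine_actD w u v : affine_act w (u + v) = affine_act w u + act w v.
Proof.
elim/(word_prod_ind hcox): w u v => [|w s IH] u v.
  by rewrite !affine_act1 geom_act1.
rewrite geom_actM // !affine_actM -IH; congr affine_act.
rewrite !affine_act_gen geom_act_simple // /affine_refl bformDr.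
by apply/ffunP => i; rewrite !ffunE /GRing.scale /=; ring.
Qed.

(** The affine reflection along a root [c] fixes [v] exactly when this form vanishes at [c]. *)
Definition affine_form v u : R := B v u + x u.

Lemma affine_form_scalar v : scalar (affine_form v).
Proof. by move=> a u u'; rewrite /affine_form bform_scalar xlin; ring. Qed.

(** This equivariance carries the formula for a simple reflection over to all its conjugates. *)
Lemma affine_form_act w v u : affine_form (affine_act w v) (act w u) = affine_form v u.
Proof.
elim/(word_prod_ind hcox): w u v => [|w s IH] u v.
  by rewrite affine_act1 geom_act1.
rewrite geom_actM // affine_actM IH affine_act_gen geom_act_simple //.
rewrite /affine_form /affine_refl -!scaleNr ![_ + (- _) *: _]addrC.
rewrite bform_scalarl xlin !bform_scalar bform_simple_diag [B v (alpha s)]bformC; ring.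
Qed.

Lemma affine_act_reflection c r v : reflection_along g c r ->
  affine_act r v = v - (2 * affine_form v c) *: c.
Proof.
move=> [w [s [-> ->]]]; rewrite !affine_actM affine_act_gen /affine_refl.
rewrite affine_actD affine_actVK geom_actN geom_actZ.
have := affine_form_act w (affine_act w^-1%g v) (alpha s).
by rewrite affine_actVK => ->; rewrite /affine_form bformC.
Qed.

(** Each reflection moves its argument by a multiple of its root, and [b] collects the multiples. If
    all are zero, no factor moves [v], so every factor is evaluated at [v] itself. *)
Lemma affine_act_prod n (c : 'I_n -> V) (r : 'I_n -> W) v :
    (forall i, reflection_along g (c i) (r i)) ->
  exists b : 'I_n -> R,
    affine_act (\prod_(i < n) r i)%g v = v - \sum_i b i *: c i /\
    ((forall i, b i = 0) -> forall i, affine_form v (c i) = 0).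
Proof.
elim: n c r => [|n IH] c r refl.
  by exists (fun=> 0); rewrite !big_ord0 affine_act1 subr0; split=> // _ [].
have [b [bE b0]] := IH (c \o lift ord0) (r \o lift ord0) (fun i => refl _).
set v' := affine_act _ v in bE.
(* The reflection along [c ord0] acts last, so its coefficient is read at [v'], the point already
   moved by the other factors. *)
exists (fun i => oapp b (2 * affine_form v' (c ord0)) (unlift ord0 i)); split.
  rewrite !big_ord_recl affine_actM -[affine_act (bigop _ _ _) v]/v'.
  rewrite (affine_act_reflection _ (refl ord0)) unlift_none /= {1}bE.
  under [in RHS]eq_bigr do rewrite liftK.
  by rewrite opprD addrA addrAC.
move=> b_eq0; have v'E : v' = v.
  rewrite bE big1 ?subr0 // => i _.
  by have := b_eq0 (lift ord0 i); rewrite liftK /= => ->; rewrite scale0r.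
move=> i; case: (unliftP ord0 i) => [j ->|->].
  by apply: b0 => k; have := b_eq0 (lift ord0 k); rewrite liftK.
have := b_eq0 ord0; rewrite unlift_none /= v'E => /eqP.
by rewrite mulf_eq0 pnatr_eq0 => /eqP.
Qed.

Lemma affine_act_standard (I : set S) w : (forall s, I s -> x (alpha s) = 0) ->
  standard_parabolic g I w -> affine_act w 0 = 0.
Proof.
move=> xI wI; pose H := [set w | affine_act w 0 = 0].
apply: (smallest_sub (X := H) _ _ wI).
- split; first by apply/asboolP/affine_act1.
  move=> a b /asboolP aH /asboolP bH; apply/asboolP.
  by rewrite /H /= affine_actM -[in affine_act b^-1%g _]bH affine_actK.
- move=> _ [s /xI xs <-]; rewrite /H /= affine_act_gen /affine_refl xs addr0.
  by rewrite (scalar0 (bform_scalar _)) mulr0 scale0r subr0.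
Qed.

End Affine.

(** * Products of reflections along independent roots *)

Lemma nth_mktuple_ord n (c : 'I_n -> V) (i : 'I_n) : [tuple c j | j < n]`_i = c i.
Proof. by rewrite -[RHS](tnth_mktuple c) (tnth_nth 0). Qed.

Lemma free_card_basis n (c : 'I_n -> V) : n = #|S| -> free [tuple c i | i < n] ->
  basis_of fullv [tuple c i | i < n].
Proof.
move=> nS cfree; rewrite basisEfree cfree subvf size_tuple nS /=.
have spanS : (fullv <= <<[seq alpha s | s <- enum S]>>)%VS.
  apply/subvP => v _; rewrite [v]simple_root_basis memv_suml // => s _.
  by rewrite memvZ // memv_span // map_f // mem_enum.
by rewrite (leq_trans (dimvS spanS)) // (leq_trans (dim_span _)) // size_map -cardE.
Qed.

Lemma essential_prod_reflections n (c : 'I_n -> V) (r : 'I_n -> W) :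
    n = #|S| -> free [tuple c i | i < n] ->
    (forall i, reflection_along g (c i) (r i)) ->
  essential g (\prod_(i < n) r i)%g.
Proof.
move=> nS cfree refl; set w := (\prod_(i < n) r i)%g.
apply: not_proper_essential => u I s Is [h hI hE].
pose x (v : V) : R := v s.
have xlin : scalar x by have [] := coord_tits_cone s.
have xI t : I t -> x (alpha t) = 0.
  by move=> It; rewrite /x ffunE; case: eqVneq => // st; case: Is; rewrite st.
pose v := affine_act x u 0.
have wv : affine_act x w v = v.
  by rewrite -hE !affine_actM // affine_actK // (affine_act_standard xI hI).
have [b [bE b0]] := affine_act_prod xlin v refl.
have fc i : affine_form x v (c i) = 0.
  apply: b0; have /freeP c_indep := cfree; apply: c_indep.
  under eq_bigr do rewrite nth_mktuple_ord.
  move: bE; rewrite -/w wv => /eqP.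
  by rewrite eq_sym -subr_eq0 addrAC subrr add0r oppr_eq0 => /eqP.
have f0 (y : V) : affine_form x v y = 0.
  rewrite (coord_basis (free_card_basis nS cfree) (memvf y)).
  have flin := affine_form_scalar xlin v.
  have f00 := scalar0 flin.
  elim/big_ind: _ => // [a a' fa fa'|i _].
    by rewrite -[a]scale1r flin fa fa' mulr0 addr0.
  by rewrite nth_mktuple_ord -[_ *: _]addr0 flin fc f00 mulr0 addr0.
(* Moving [v] back to the origin turns the form into [x], which is 1 at [alpha s]. *)
have := f0 (act u (alpha s)); rewrite affine_form_act // /affine_form.
rewrite bformC (scalar0 (bform_scalar _)) add0r /x ffunE eqxx => /eqP.
by rewrite oner_eq0.
Qed.

(** The factors are the reflections along the simple roots in the order of the word, which are
    independent because the letters are distinct. *)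
Lemma coxeter_element_essential w : coxeter_element g w -> essential g w.
Proof.
move=> [l lE ->]; have sizeS : size l = #|S| by rewrite (perm_size lE) cardE.
rewrite /word_prod big_tnth.
apply: (@essential_prod_reflections _ (fun i => alpha (tnth (in_tuple l) i))) => //.
  apply/freeP => k k0 i.
  have := congr1 (fun v : V => v (tnth (in_tuple l) i)) k0.
  rewrite sum_ffunE ffunE (bigD1 i) //= big1 ?addr0 => [|j ji].
    by rewrite nth_mktuple_ord !ffunE eqxx /GRing.scale /= mulr1.
  rewrite nth_mktuple_ord !ffunE.
  have /negPf -> : tnth (in_tuple l) i != tnth (in_tuple l) j.
    have /tuple_uniqP tnth_inj : uniq (in_tuple l) by rewrite (perm_uniq lE) enum_uniq.
    by rewrite (inj_eq tnth_inj) eq_sym.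
  exact: mulr0.
move=> i; exists 1%g, (tnth (in_tuple l) i).
by rewrite geom_act1 // invg1 mulg1 mul1g.
Qed.

End Roots.

Theorem theorem4p1 (R : realType) (W : groupType) (S : finType) (g : S -> W)
    (hcox : coxeter_system g) (hinf : infinite_set [set: W])
    (hirr : irreducible_system g) :
  [/\ (* (1) *)
      forall w : W, essential g w -> infinite_order w,
      (* (2) *)
      forall k : int, k != 0%R ->
        forall w : W, essential g w <-> essential g (zpow w k),
      (* (3) *)
      forall (n : nat) (c : 'I_n -> geom_space R S) (r : 'I_n -> W),
        n = #|S| ->
        (forall i, root_system g (c i)) ->
        free [tuple c i | i < n] ->
        (forall i, reflection_along g (c i) (r i)) ->
        essential g (\prod_(i < n) r i)
    & forall w : W, coxeter_element g w -> essential g w].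
Proof.
have powS := essential_expgS R hcox hinf hirr.
have of_pow := essential_of_expg R hcox.
have inv := essential_inv R hcox.
split.
- move=> w ess [//|n] _ w1.
  by apply: (not_essential1 R hcox hinf); rewrite -w1; apply: powS.
- case=> [[//|n]|n] _ w; split=> /= ess.
  + exact: powS.
  + exact: of_pow ess.
  + exact/inv/powS.
  + by apply: (of_pow _ n.+1); rewrite -[_ ^+ _]invgK; apply: inv.
- by move=> n c r nS _ cfree refl; apply: (@essential_prod_reflections R _ _ _ hcox n c).
- exact: (coxeter_element_essential R hcox).
Qed.
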